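(* Let $d$ be a positive integer with $d\geq2$ and set $A=S_d$. Then, for each $a\in\{0,1\}$, the hypergraph $\mathfrak H_A(2^d,4,a)$ is a $\operatorname{PBIBD}(2^d,4;\lambda_1^{(a)},\dots,\lambda_d^{(a)})$ on the binary Hamming scheme $\mathcal H(d)$, where $$\lambda_1^{(a)}=(1-a)\binom{2^d}{4}+(2a-1)\bigl(d^2+d(2^{d-1}-5-a)+3+a\bigr),$$ $$\lambda_2^{(a)}=(1-a)\binom{2^d}{4}+(2a-1)(d^2-3-a),$$ $$\lambda_i^{(a)}=(1-a)\binom{2^d}{4}+(2a-1)d^2\quad\text{for each }i\in\{3,\dots,d\}.$$
   Context: The matrices $S_d$ are defined inductively by $S_0=[0]$ (the $1\times1$ zero matrix) and $S_{d+1}=\begin{bmatrix}S_d&I\\ I&-S_d\end{bmatrix}$; $S_d$ has order $2^d$ with rows and columns indexed by $[2^d]=\{1,\dots,2^d\}$. The hypercube $Q_d$ is the graph on $[2^d]$ in which $x,y$ are adjacent iff $(S_d)_{xy}=\pm1$. The binary Hamming scheme is the symmetric association scheme $\mathcal H(d)=([2^d],\{R_i\}_{i=0}^d)$, where $R_i=\{(x,y)\in[2^d]\times[2^d]: d(x,y)=i\}$ and $d(x,y)$ is the graph distance in $Q_d$. For a $v\times v$ matrix $A$, $\mathfrak H_A(v,k,a)$ is the $k$-uniform hypergraph on $[v]=\{1,\dots,v\}$ whose hyperedges are the $k$-subsets $\alpha\subset[v]$ with $\det(A[\alpha])=a$, where $A[\alpha]$ is the principal submatrix of $A$ indexed by $\alpha$.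 For positive integers $t,v,k,\lambda$, a $t$-$(v,k,\lambda)$ design (or $t$-design) is a $k$-uniform hypergraph on a $v$-element vertex set such that any set of $t$ vertices appear together in precisely $\lambda$ hyperedges. A $\operatorname{PBIBD}(v,k;\lambda_1,\dots,\lambda_d)$ (partially balanced incomplete block design) on a symmetric association scheme $([v],\{R_i\}_{i=0}^d)$ is a $k$-uniform $1$-design on $[v]$ such that, for each $i\in\{1,\dots,d\}$ and each $(x,y)\in R_i$, the pair $\{x,y\}$ is contained in exactly $\lambda_i$ hyperedges.
   Formalization: In all three formulas the printed binomial (2^d choose 4) is corrected to (2^d−2 choose 2), since the printed value fails for a=0, d≥3 (d=3 gives 61 > 15); also a 1-design may have λ=0, needed at d=2, where both hypergraphs are empty. *)

(* Defs.v *)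
From mathcomp Require Import all_boot all_order all_algebra.

Set Implicit Arguments.
Unset Strict Implicit.
Unset Printing Implicit Defensive.

Import GRing.Theory.

Lemma expn2S (d : nat) : 2 ^ d + 2 ^ d = 2 ^ d.+1.
Proof. by rewrite expnS mul2n addnn. Qed.

(* The cast is needed because 2 ^ d.+1 does not reduce to 2 ^ d + 2 ^ d. *)
Fixpoint signed_cube (d : nat) : 'M[int]_(2 ^ d) :=
  if d is d'.+1 then
    castmx (expn2S d', expn2S d')
      (block_mx (signed_cube d') 1%:M 1%:M (- signed_cube d')%R)
  else 0%R.

Definition hypercube (d : nat) : rel 'I_(2 ^ d) :=
  [rel x y | (signed_cube d x y == 1%R) || (signed_cube d x y == (-1)%R)].

(* The least length of a walk from x to y. A shortest walk has fewer than #|T|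
   steps, so the value is #|T| exactly when y is not reachable from x. *)
Definition graph_dist (T : finType) (e : rel T) (x y : T) : nat :=
  find (fun n => [exists p : n.-tuple T, path e x p && (last x p == y)])
       (iota 0 #|T|).

Definition hamming_scheme (d : nat) : 'I_d.+1 -> rel 'I_(2 ^ d) :=
  fun i x y => graph_dist (@hypercube d) x y == i.

Definition symmetric_scheme (T : finType) (d : nat)
    (R : 'I_d.+1 -> rel T) : Prop :=
  [/\ forall i, exists x y, R i x y,
      forall x y, R ord0 x y = (x == y),
      forall x y, exists! i, R i x y,
      forall i, symmetric (R i)
    & forall i j k, exists p : nat,
        forall x y, R k x y -> #|[set z | R i x z && R j z y]| = p].

Definition principal (v : nat) (A : 'M[int]_v) (alpha : {set 'I_v}) :
    'M[int]_#|alpha| :=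
  \matrix_(i, j) A (enum_val i) (enum_val j).

(* A hypergraph is represented by its set of hyperedges. *)
Definition det_hypergraph (v : nat) (A : 'M[int]_v) (k : nat) (a : int) :
    {set {set 'I_v}} :=
  [set alpha : {set 'I_v} | (#|alpha| == k) &&
     ((\det (principal A alpha))%R == a)].

(* lambda = 0 is allowed, so that a hypergraph without hyperedges is a design. *)
Definition design (t v k lambda : nat) (H : {set {set 'I_v}}) : Prop :=
  [/\ [/\ 0 < t, 0 < v & 0 < k],
      forall alpha, alpha \in H -> #|alpha| = k
    & forall s : {set 'I_v}, #|s| = t ->
        #|[set alpha in H | s \subset alpha]| = lambda].

(* Only the values lambda 1, ..., lambda d matter. They are integers so that
   they can be given by formulas with genuine subtraction. *)
Definition PBIBD (v k d : nat) (lambda : nat -> int)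
    (R : 'I_d.+1 -> rel 'I_v) (H : {set {set 'I_v}}) : Prop :=
  [/\ symmetric_scheme R,
      exists r : nat, design 1 k r H
    & forall i : 'I_d.+1, 0 < i -> forall x y, R i x y ->
        Posz #|[set alpha in H | [set x; y] \subset alpha]| = lambda i].

(* Main.v *)
Require Import Defs.
From mathcomp Require Import all_boot all_order all_algebra.
From mathcomp Require Import perm ring zify.

(* Since S_d ^ 2 = d I and two distinct vertices of the hypercube have 0 or 2
   common neighbours, the signs around every quadrangle multiply to -1.
   Expanding the determinant over permutations without fixed points, this
   makes det S_d[{x, y, z, w}] the square of the number of perfect
   matchings of the subgraph induced on {x, y, z, w}. A product of three
   distinct matchings would force a triangle, so inclusion-exclusion over
   the three pairings expresses the indicator that this number is 0 (or 1)
   as a polynomial in the adjacencies, and summing it over the ordered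
   pairs (z, w) only uses the degree d, the codegrees and the absence of
   triangles. The reflection and coordinate symmetries of the cube give
   the association scheme, and the constancy of the replication number. *)

Set Implicit Arguments.
Unset Strict Implicit.
Unset Printing Implicit Defensive.

Import GRing.Theory Num.Theory.
Local Open Scope ring_scope.

(** * Hamming distance and the hypercube *)

Definition ham (I : finType) (x y : {ffun I -> bool}) : nat :=
  \sum_i (x i (+) y i)%N.

Definition flip (I : finType) (x : {ffun I -> bool}) (i : I) :
  {ffun I -> bool} := [ffun j => x j (+) (j == i)].

Section Hamming.
Variable I : finType.
Implicit Types x y z : {ffun I -> bool}.

Lemma ham_sym x y : ham x y = ham y x.
Proof. by apply: eq_bigr => i _; rewrite addbC. Qed.

Lemma ham_eq0 x y : (ham x y == 0)%N = (x == y).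
Proof.
rewrite sum_nat_eq0; apply/forall_inP/eqP => [h|-> i _]; last by rewrite addbb.
by apply/ffunP => i; move: (h i isT); case: (x i); case: (y i).
Qed.

Lemma hamxx x : ham x x = 0%N.
Proof. by apply/eqP; rewrite ham_eq0. Qed.

Lemma ham_triangle x y z : (ham x z <= ham x y + ham y z)%N.
Proof.
rewrite -big_split /=; apply: leq_sum => i _.
by case: (x i); case: (y i); case: (z i).
Qed.

Lemma ham_le x y : (ham x y <= #|I|)%N.
Proof. by rewrite -sum1_card; apply: leq_sum => i _; apply: leq_b1. Qed.

Lemma ham_flip x y i :
  ham (flip x i) y = if x i (+) y i then (ham x y).-1 else (ham x y).+1.
Proof.
have e : (\sum_(j | j != i) (flip x i j (+) y j) =
  \sum_(j | j != i) (x j (+) y j))%N.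
  by apply: eq_bigr => j /negbTE ji; rewrite ffunE ji addbF.
rewrite /ham (bigD1 i) //= e [in RHS](bigD1 i) //= ffunE eqxx.
by case: (x i); case: (y i).
Qed.

Lemma ham_flipx x i : ham (flip x i) x = 1%N.
Proof. by rewrite ham_flip addbb hamxx. Qed.

Lemma flip_inj x : injective (flip x).
Proof.
move=> i j /ffunP/(_ i); rewrite !ffunE eqxx => /addbI.
by case: eqP.
Qed.

Lemma ham_gt0_flip x y : (0 < ham x y)%N ->
  exists i, ham (flip x i) y = (ham x y).-1.
Proof.
rewrite lt0n sum_nat_eq0 negb_forall => /existsP[i]; rewrite /= eqb0 negbK => h.
by exists i; rewrite ham_flip h.
Qed.

Lemma ham1P x y : (ham x y == 1)%N = [exists i, y == flip x i].
Proof.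
apply/eqP/existsP => [h|[i /eqP->]]; last by rewrite ham_sym ham_flipx.
have [|i hi] := @ham_gt0_flip x y; first by rewrite h.
by exists i; rewrite eq_sym -ham_eq0 hi h.
Qed.

(** Neighbours of [x] correspond to coordinates through [flip], so degrees and codegrees become
    counts of coordinates. *)
Lemma card_ham1 x (P : pred {ffun I -> bool}) :
  #|[set z | (ham x z == 1)%N && P z]| = #|[set i | P (flip x i)]|.
Proof.
rewrite -(card_imset _ (@flip_inj x)); apply: eq_card => z.
rewrite !inE ham1P; apply/andP/imsetP => [[/existsP[i /eqP->] hP]|[i]].
  by exists i; rewrite ?inE.
by rewrite inE => hP ->; split => //; apply/existsP; exists i.
Qed.

Lemma ham_degree x : #|[set z | (ham x z == 1)%N]| = #|I|.
Proof.
have := card_ham1 x xpredT; rewrite cardsT => <-.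
by apply: eq_card => z; rewrite !inE andbT.
Qed.

(** A flip of [x] changes its distance to [y] by exactly one. As [x] and [y] differ, it gives a
    neighbour of [y] only when they are at distance 2, and then precisely at the two coordinates
    where they differ. *)
Lemma ham_codegree x y : x != y ->
  #|[set z | (ham x z == 1)%N && (ham y z == 1)%N]| = (2 * (ham x y == 2))%N.
Proof.
rewrite -ham_eq0 => h0; rewrite (card_ham1 x (fun z => ham y z == 1)%N).
have [h2|h2] := eqVneq.
  transitivity (ham x y); last by rewrite h2.
  rewrite -sum1dep_card big_mkcond /=; apply: eq_bigr => i _.
  by rewrite ham_sym ham_flip h2; case: (x i); case: (y i).
apply/eqP; rewrite muln0 cards_eq0; apply/eqP/setP => i; rewrite !inE.
rewrite ham_sym ham_flip; move: h0 h2.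
by case: (x i (+) y i); case: (ham x y) => [|[|[|k]]].
Qed.

End Hamming.

(** * Isometries of the cube *)

Lemma exists_perm_bool (d : nat) (f g : 'I_d -> bool) :
  (\sum_i f i = \sum_i g i)%N -> exists s : 'S_d, forall i, g (s i) = f i.
Proof.
move=> h.
have cnt (k : 'I_d -> bool) :
  (count_mem true [tuple k i | i < d] = \sum_i k i)%N.
  rewrite -sum1_count big_map big_enum_cond /= big_mkcond /=.
  by apply: eq_bigr => i _; case: (k i).
have cntF (k : 'I_d -> bool) :
  (count_mem false [tuple k i | i < d] = d - \sum_i k i)%N.
  rewrite -cnt -[X in (X - _)%N](size_tuple [tuple k i | i < d]).
  rewrite -(count_predC (pred1 true)) addKn.
  by apply: eq_count => -[].
have : perm_eq [tuple f i | i < d] [tuple g i | i < d].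
  by apply/allP => -[] _ /=; rewrite ?cnt ?cntF h.
case/tuple_permP => p hp; exists p => i.
have /(congr1 (fun s => nth false s i)) := hp.
rewrite -!tnth_nth !tnth_mktuple => ->.
by [].
Qed.

(** Distance transitivity of the cube: it later yields the intersection numbers of the scheme and
    the constancy of the replication number. *)
Lemma ham_isometry (d : nat) (x y x' y' : {ffun 'I_d -> bool}) :
  ham x y = ham x' y' ->
  exists phi : {ffun 'I_d -> bool} -> {ffun 'I_d -> bool},
    [/\ injective phi, forall u v, ham (phi u) (phi v) = ham u v,
        phi x = x' & phi y = y'].
Proof.
move=> h; have [s hs] := exists_perm_bool (esym h).
(* Translate [x] to the origin, permute coordinates by [s], which carries the difference of [x] and
   [y] to that of [x'] and [y'], then translate the origin to [x']. *)
pose phi (u : {ffun 'I_d -> bool}) :=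
  [ffun j => u (s j) (+) x (s j) (+) x' j].
have hphi u v : ham (phi u) (phi v) = ham u v.
  rewrite /ham [RHS](reindex_inj (@perm_inj _ s)); apply: eq_bigr => j _.
  by rewrite !ffunE; case: (u _); case: (v _); case: (x _); case: (x' _).
exists phi; split=> //.
- by move=> u v uv; apply/eqP; rewrite -ham_eq0 -hphi uv hamxx.
- by apply/ffunP => j; rewrite ffunE addbb.
apply/ffunP => j; rewrite ffunE; move: (hs j).
by case: (x _); case: (x' _); case: (y _); case: (y' _).
Qed.

(** * Binary codes of the vertices *)

Definition bits (d x : nat) : {ffun 'I_d -> bool} :=
  [ffun i : 'I_d => odd (x %/ 2 ^ i)].

Lemma bits_inj (d x y : nat) : (x < 2 ^ d)%N -> (y < 2 ^ d)%N ->
  bits d x = bits d y -> x = y.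
Proof.
elim: d x y => [|d IHd] x y; first by rewrite expn0; case: x; case: y.
rewrite expnS => hx hy /ffunP h.
have o : odd x = odd y by have := h ord0; rewrite !ffunE expn0 !divn1.
rewrite -(odd_double_half x) -(odd_double_half y) o; congr (_ + _.*2)%N.
apply: IHd; [lia | lia |].
apply/ffunP => i; have := h (lift ord0 i).
by rewrite !ffunE /= /bump /= expnS !divnMA !divn2.
Qed.

(** The top bit is the block index in the recursion for [signed_cube]. Adding [b * 2 ^ d] leaves the
    lower bits alone, since its quotient by [2 ^ i] is even for [i < d]. *)
Lemma ham_bitsS (d x y : nat) (b c : bool) : (x < 2 ^ d)%N -> (y < 2 ^ d)%N ->
  ham (bits d.+1 (b * 2 ^ d + x)) (bits d.+1 (c * 2 ^ d + y)) =
  (ham (bits d x) (bits d y) + (b (+) c))%N.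
Proof.
move=> hx hy; rewrite /ham big_ord_recr /= !ffunE /=.
rewrite !divnMDl ?expn_gt0 // !divn_small // !addn0 !oddb; congr (_ + _)%N.
apply: eq_bigr => i _; rewrite !ffunE /=.
have low (e : bool) z : odd ((e * 2 ^ d + z) %/ 2 ^ i) = odd (z %/ 2 ^ i).
  have := ltn_ord i; move: (nat_of_ord i) => k kd.
  rewrite -(subnK (ltnW kd)) expnD mulnA divnMDl ?expn_gt0 //.
  by rewrite oddD oddM oddX subn_eq0 leqNgt kd andbF.
by rewrite !low.
Qed.

Section Code.
Variable d : nat.
Definition code (x : 'I_(2 ^ d)) : {ffun 'I_d -> bool} := bits d x.

Lemma code_inj : injective code.
Proof. by move=> x y h; apply/val_inj/(bits_inj (ltn_ord x) (ltn_ord y) h). Qed.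

Lemma code_bij : bijective code.
Proof.
by apply: inj_card_bij code_inj _; rewrite card_ffun card_bool !card_ord.
Qed.

Lemma card_code (P : pred {ffun 'I_d -> bool}) :
  #|[set x | P (code x)]| = #|[set z | P z]|.
Proof.
by rewrite -!sum1dep_card [RHS](reindex code) //; apply: onW_bij code_bij.
Qed.

Lemma code_isometry (x y x' y' : 'I_(2 ^ d)) :
  ham (code x) (code y) = ham (code x') (code y') ->
  exists phi : 'I_(2 ^ d) -> 'I_(2 ^ d),
    [/\ injective phi,
        forall u v, ham (code (phi u)) (code (phi v)) = ham (code u) (code v),
        phi x = x' & phi y = y'].
Proof.
case/ham_isometry => phi [phi_inj hphi hx hy]; case: code_bij => dec codeK decK.
exists (dec \o phi \o code); split=> [u v /= huv|u v|/=|/=].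
- exact/code_inj/phi_inj/(can_inj decK).
- by rewrite /= !decK.
- by rewrite hx.
by rewrite hy.
Qed.
End Code.

(** * Entries and square of the signed cube matrix *)

Definition half_emb (d : nat) (b : bool) (a : 'I_(2 ^ d)) : 'I_(2 ^ d.+1) :=
  cast_ord (expn2S d) (if b then rshift _ a else lshift _ a).

Lemma half_embP (d : nat) (x : 'I_(2 ^ d.+1)) : exists b a, x = half_emb b a.
Proof.
have e : x = cast_ord (expn2S d) (cast_ord (esym (expn2S d)) x).
  by rewrite cast_ordKV.
move: (cast_ord _ x) e => u ->; rewrite -[u]splitK.
by case: (split u) => a; [exists false, a | exists true, a].
Qed.

Lemma signed_cube_half (d : nat) (b c : bool) (x y : 'I_(2 ^ d)) :
  signed_cube d.+1 (half_emb b x) (half_emb c y) =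
  if b (+) c then (x == y)%:R else (-1) ^+ b * signed_cube d x y.
Proof.
rewrite /= castmxE /half_emb !cast_ordK.
case: b; case: c => /=; rewrite ?block_mxEul ?block_mxEur ?block_mxEdl
  ?block_mxEdr ?mxE ?expr1 ?expr0 ?mul1r ?mulN1r //.
Qed.

Lemma ham_half (d : nat) (b c : bool) (x y : 'I_(2 ^ d)) :
  ham (code (half_emb b x)) (code (half_emb c y)) =
  (ham (code x) (code y) + (b (+) c))%N.
Proof.
have val_half (e : bool) (z : 'I_(2 ^ d)) :
  half_emb e z = (e * 2 ^ d + z)%N :> nat by case: e; rewrite /= ?mul1n.
by rewrite /code !val_half ham_bitsS.
Qed.

(** Induction on the blocks: the off-diagonal identities join the vertices that differ only in the
    top bit, and the diagonal blocks are the smaller matrix up to a sign that the norm forgets. *)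
Lemma signed_cube_norm (d : nat) (x y : 'I_(2 ^ d)) :
  `|signed_cube d x y| = (ham (code x) (code y) == 1%N)%:R.
Proof.
elim: d x y => [|d IHd] x y; first by rewrite mxE normr0 /ham big_ord0.
have [b [{}x ->]] := half_embP x; have [c [{}y ->]] := half_embP y.
rewrite signed_cube_half ham_half; case: (b (+) c).
  by rewrite addn1 eqSS ham_eq0 (inj_eq (@code_inj d)) normr_nat.
by rewrite addn0 normrM normrX normrN1 expr1n mul1r IHd.
Qed.

Lemma signed_cube_sym (d : nat) : (signed_cube d)^T = signed_cube d.
Proof.
elim: d => [|d IHd] /=; first by rewrite trmx0.
by rewrite trmx_cast tr_block_mx linearN /= trmx1 IHd.
Qed.

(** The opposite signs of the diagonal blocks cancel the off-diagonal blocks of the square, and the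
    identities add 1 to each diagonal block. *)
Lemma signed_cube_sqr (d : nat) :
  signed_cube d *m signed_cube d = (d%:R)%:M.
Proof.
(* The order is generalised because [expn2S d] has no variable side and cannot be eliminated
   directly. *)
have cast_mul m n (e : m = n) (A B : 'M[int]_m) :
  castmx (e, e) A *m castmx (e, e) B = castmx (e, e) (A *m B).
  by case: _ / e.
have cast_scalar m n (e : m = n) (a : int) : castmx (e, e) a%:M = a%:M.
  by case: _ / e.
elim: d => [|d IHd] /=; first by rewrite mul0mx -scalemx1 scale0r.
rewrite cast_mul mulmx_block !mul1mx !mulmx1 mulNmx mulmxN opprK IHd.
rewrite subrr [1%:M + _]addrC -(raddfD (@scalar_mx _ _)) /= natr1.
by rewrite -scalar_mx_block cast_scalar.
Qed.

(** * Graph distance in the hypercube *)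

Lemma hypercube_ham (d : nat) (x y : 'I_(2 ^ d)) :
  hypercube x y = (ham (code x) (code y) == 1%N).
Proof.
have := signed_cube_norm x y; rewrite /hypercube /=.
case: eqP => _ h; last first.
  by move/eqP: h; rewrite normr_eq0 => /eqP ->.
have : signed_cube d x y ^+ 2 == 1 by rewrite -real_normK ?num_real // h expr1n.
by rewrite sqrf_eq1.
Qed.

Lemma path_hypercube_ge (d : nat) (x y : 'I_(2 ^ d)) (p : seq 'I_(2 ^ d)) :
  path (@hypercube d) x p -> last x p = y ->
  (ham (code x) (code y) <= size p)%N.
Proof.
elim: p x => [|z p IHp] x /= => [_ ->|/andP[hxz hp] hl]; first by rewrite hamxx.
apply: leq_trans (ham_triangle _ (code z) _) _.
by move: hxz; rewrite hypercube_ham => /eqP->; rewrite ltnS IHp.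
Qed.

Lemma path_hypercube_ham (d n : nat) (x y : 'I_(2 ^ d)) :
  ham (code x) (code y) = n ->
  exists p : n.-tuple 'I_(2 ^ d),
    path (@hypercube d) x p && (last x p == y).
Proof.
elim: n x => [|n IHn] x h.
  exists [tuple] => /=; rewrite -(inj_eq (@code_inj d)) -ham_eq0.
  by rewrite h.
have [|i hi] := @ham_gt0_flip _ (code x) (code y); first by rewrite h.
have [dec codeK decK] := code_bij d.
have [|p hp] := IHn (dec (flip (code x) i)); first by rewrite decK hi h.
exists [tuple of dec (flip (code x) i) :: p]; rewrite /= hypercube_ham decK.
by rewrite ham_sym ham_flipx.
Qed.

Lemma graph_dist_hypercube (d : nat) (x y : 'I_(2 ^ d)) :
  graph_dist (@hypercube d) x y = ham (code x) (code y).
Proof.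
rewrite /graph_dist card_ord; set P := fun n : nat => _.
set k := ham _ _.
(* The distance lies in the range searched by [find], so the default value for unreachable vertices
   does not occur. *)
have kd : (k < 2 ^ d)%N.
  by apply: leq_ltn_trans (ham_le _ _) _; rewrite card_ord ltn_expl.
have Pk : P k by apply/existsP/path_hypercube_ham.
have Pge n : P n -> (k <= n)%N.
  case/existsP => p /andP[hp /eqP hl].
  by have := path_hypercube_ge hp hl; rewrite size_tuple.
have hasP : has P (iota 0 (2 ^ d)).
  by apply/hasP; exists k => //; rewrite mem_iota.
have fd : (find P (iota 0 (2 ^ d)) < 2 ^ d)%N.
  by rewrite -[X in (_ < X)%N](size_iota 0) -has_find.
apply/eqP; rewrite eqn_leq Pge ?andbT; last first.
  by have := nth_find 0%N hasP; rewrite nth_iota.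
rewrite leqNgt; apply/negP => /(before_find 0%N).
by rewrite nth_iota // add0n Pk.
Qed.

(** * The Hamming scheme as an association scheme *)

Lemma hamming_schemeE (d : nat) (i : 'I_d.+1) (x y : 'I_(2 ^ d)) :
  hamming_scheme i x y = (ham (code x) (code y) == i).
Proof. by rewrite /hamming_scheme graph_dist_hypercube. Qed.

Lemma symmetric_scheme_hamming (d : nat) : symmetric_scheme (@hamming_scheme d).
Proof.
have [dec codeK decK] := code_bij d.
split.
- move=> i.
  (* The origin and the word with ones in its first [i] positions are at distance [i]. *)
  exists (dec [ffun=> false]), (dec [ffun j : 'I_d => (j < i)%N]).
  rewrite hamming_schemeE !decK; apply/eqP.
  rewrite /ham -[RHS](card_ord i) -sum1_card.
  rewrite (big_ord_widen d (fun=> 1%N)) -1?ltnS //= [RHS]big_mkcond /=.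
  by apply: eq_bigr => j _; rewrite !ffunE; case: (_ < _)%N.
- by move=> x y; rewrite hamming_schemeE ham_eq0 (inj_eq (@code_inj d)).
- move=> x y; have := ham_le (code x) (code y); rewrite card_ord -ltnS => h.
  exists (Ordinal h); split=> [|j]; rewrite hamming_schemeE //=.
  by move/eqP => e; apply/val_inj.
- by move=> i x y; rewrite !hamming_schemeE ham_sym.
move=> i j k.
have [[x0 y0] /= h0|none] := pickP (fun u => hamming_scheme k u.1 u.2);
  last first.
  by exists 0%N => x y h; have := none (x, y); rewrite /= h.
(* The count at one reference pair serves for all pairs of the class, since an isometry carries any
   of them to it. *)
exists #|[set z | hamming_scheme i x0 z && hamming_scheme j z y0]| => x y.
move: h0; rewrite !hamming_schemeE => /eqP h0 /eqP h.
have [phi [phi_inj hphi hx hy]] := code_isometry (etrans h (esym h0)).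
rewrite -!sum1dep_card [RHS](reindex_inj phi_inj); apply: eq_bigl => z.
by rewrite !hamming_schemeE -hx -hy !hphi.
Qed.

(** * Principal minors of order four *)

(** The enumeration [f] and [enum_val] differ by a permutation that acts on rows and columns alike,
    so its sign appears twice and cancels. *)
Lemma det_principal (v n : nat) (A : 'M[int]_v) (f : 'I_n -> 'I_v) :
  injective f ->
  \det (principal A (f @: setT)) = \det (\matrix_(i, j) A (f i) (f j)).
Proof.
move=> f_inj; set al := f @: setT.
have e : n = #|al| by rewrite card_imset // cardsT card_ord.
have fal i : f i \in al by apply: imset_f.
pose g i := cast_ord (esym e) (enum_rank_in (fal i) (f i)).
have gE i : enum_val (cast_ord e (g i)) = f i.
  by rewrite /g cast_ordKV enum_rankK_in.
have g_inj : injective g by move=> i j ij; apply: f_inj; rewrite -!gE ij.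
(* Abstracting [enum_val] frees the cardinal of [al], so that the equality [e] can be eliminated. *)
move: g gE g_inj; rewrite /principal; move: (@enum_val _ al) => h.
case: _ / e h => h g gE g_inj.
pose s := perm g_inj.
have -> : \matrix_(i, j) A (f i) (f j) =
  row_perm s (col_perm s (\matrix_(i, j) A (h i) (h j))).
  apply/matrixP => i j; rewrite !mxE !permE.
  by rewrite -!gE /= !cast_ord_id.
by rewrite row_permE col_permE !det_mulmx !det_perm odd_permV mulrCA mulrA
  -mulrA -signr_addb addbb mulr1.
Qed.

(** With zero diagonal only the nine derangements contribute: three double transpositions give the
    squares, and the six odd 4-cycles, paired with their inverses by symmetry, give the doubled
    products. *)
Lemma det_mx4 (R : comNzRingType) (a : nat -> nat -> R) :
  (forall i j, a i j = a j i) -> (forall i, a i i = 0) ->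
  \det (\matrix_(i < 4, j < 4) a i j) =
    (a 0%N 1%N * a 2%N 3%N) ^+ 2 + (a 0%N 2%N * a 1%N 3%N) ^+ 2
    + (a 0%N 3%N * a 1%N 2%N) ^+ 2
    - 2 * (a 0%N 1%N * a 2%N 3%N * (a 0%N 2%N * a 1%N 3%N)
    + a 0%N 1%N * a 2%N 3%N * (a 0%N 3%N * a 1%N 2%N)
    + a 0%N 2%N * a 1%N 3%N * (a 0%N 3%N * a 1%N 2%N)).
Proof.
move=> sy di.
rewrite (expand_det_row _ ord0) !big_ord_recl big_ord0 /cofactor.
rewrite !(expand_det_row _ (ord0 : 'I_3)) !big_ord_recl !big_ord0 /cofactor.
rewrite !(expand_det_row _ (ord0 : 'I_2)) !big_ord_recl !big_ord0 /cofactor.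
rewrite !det_mx11 !mxE /= /bump /= !(addn0, add0n) /=.
rewrite !(di, sy 1 0, sy 2 0, sy 3 0, sy 2 1, sy 3 1, sy 3 2)%N.
ring.
Qed.

(** * Signed graphs whose matrix has a scalar square *)

Definition matchings (T : eqType) (e : rel T) (x y z w : T) : nat :=
  (e x y * e z w + e x z * e y w + e x w * e y z)%N.

Section SignedGraph.
Variables (v d : nat) (A : 'M[int]_v) (e : rel 'I_v).
Hypotheses (A_sym : A^T = A) (A_sqr : A *m A = (d%:R)%:M).
Hypotheses (A_norm : forall x y, `|A x y| = (e x y)%:R).
Hypothesis e_irr : irreflexive e.
Hypothesis codegree_le2 : forall x y, x != y ->
  (#|[set z | e x z && e y z]| <= 2)%N.

Lemma signed_graph_sym x y : A x y = A y x.
Proof. by rewrite -{1}A_sym mxE. Qed.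

Lemma edge_sym : symmetric e.
Proof.
move=> x y; have : `|A x y| = `|A y x| by rewrite signed_graph_sym.
by rewrite !A_norm; case: (e x y); case: (e y x).
Qed.

Lemma signed_graph_sqr x y : A x y ^+ 2 = (e x y)%:R.
Proof. by rewrite -real_normK ?num_real // A_norm; case: (e x y). Qed.

Lemma non_edge x y : e x y = false -> A x y = 0.
Proof. by move=> h; apply/eqP; rewrite -normr_eq0 A_norm h. Qed.

(* Two-step walks from x to z cancel because A ^ 2 is scalar, so the two
   paths of a quadrangle joining opposite corners have opposite signs. *)
Lemma quadrangle_neg x y z w : x != z -> y != w ->
  A x y * A y z * (A x w * A w z) = - (e x y * e y z * (e x w * e w z))%:R.
Proof.
move=> xz yw.
case exy: (e x y); last by rewrite (non_edge exy) !mul0r oppr0.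
case eyz: (e y z); last by rewrite (non_edge eyz) mulr0 !mul0r oppr0.
case exw: (e x w); last by rewrite (non_edge exw) mul0r mulr0 oppr0.
case ewz: (e w z); last by rewrite (non_edge ewz) !mulr0 oppr0.
(* The codegree bound leaves room for no common neighbour of [x] and [z] besides [y] and [w]. *)
have nb : [set y; w] = [set u | e x u && e z u].
  apply/eqP; rewrite eqEcard cards2 yw codegree_le2 // andbT.
  apply/subsetP => u; rewrite !inE => /orP[] /eqP->.
    by rewrite exy edge_sym eyz.
  by rewrite exw edge_sym ewz.
have : (A *m A) x z = 0 by rewrite A_sqr !mxE (negbTE xz).
rewrite mxE (bigID (mem [set y; w])) /= [X in _ + X]big1 => [|u].
  rewrite addr0 big_setU1 ?inE //= big_set1 => h.
  have -> : A x w * A w z = - (A x y * A y z) by lia.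
  by rewrite mulrN -expr2 exprMn !signed_graph_sqr exy eyz.
rewrite nb inE negb_and => /orP[] /negbTE h.
  by rewrite non_edge ?mul0r.
by rewrite [A u z]non_edge ?mulr0 // edge_sym.
Qed.

(** Each mixed product in [det_mx4] runs around a quadrangle, so [quadrangle_neg] turns its
    coefficient from -2 to +2 on indicators and completes the square of the sum over the three
    pairings. *)
Lemma det_principal4 x y z w : uniq [:: x; y; z; w] ->
  \det (principal A [set x; y; z; w]) = (matchings e x y z w)%:R ^+ 2.
Proof.
move=> u; pose f (i : 'I_4) := nth x [:: x; y; z; w] i.
have f_inj : injective f.
  move=> i j /eqP; rewrite /f nth_uniq ?ltn_ord // => /eqP; exact: val_inj.
have -> : [set x; y; z; w] = f @: setT.
  apply/setP => t; apply/idP/imsetP => [|[i _ ->]].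
    rewrite !inE -!orbA => h.
    have ht : t \in [:: x; y; z; w] by rewrite !inE.
    have hi : (index t [:: x; y; z; w] < 4)%N by rewrite index_mem.
    by exists (Ordinal hi); rewrite ?inE // /f nth_index.
  by rewrite /f; case: i => -[|[|[|[|//]]]] hi; rewrite !inE eqxx ?orbT.
rewrite (det_principal A f_inj).
rewrite (det_mx4 (a := fun i j => A (nth x [:: x; y; z; w] i)
  (nth x [:: x; y; z; w] j))); last 2 first.
- by move=> i j; apply: signed_graph_sym.
- by move=> i; rewrite non_edge.
rewrite /= !exprMn !signed_graph_sqr.
move: u; rewrite /= !inE !negb_or !andbT.
case/and3P=> /and3P[xy xz xw] /andP[yz yw] zw.
(* One quadrangle for each way to split the four vertices into two pairs of opposite corners. *)
have q1 := quadrangle_neg xz yw.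
have q2 := quadrangle_neg xy zw.
have q3 := quadrangle_neg xw yz.
have t1 : A x y * A z w * (A x z * A y w) =
  - (e x y * e y w * (e x z * e z w))%:R by rewrite -q3; ring.
have t2 : A x y * A z w * (A x w * A y z) =
  - (e x y * e y z * (e x w * e w z))%:R.
  by rewrite -q1 (signed_graph_sym w z); ring.
have t3 : A x z * A y w * (A x w * A y z) =
  - (e x z * e z y * (e x w * e w y))%:R.
  by rewrite -q2 (signed_graph_sym z y) (signed_graph_sym w y); ring.
rewrite t1 t2 t3 /matchings (edge_sym w z) (edge_sym z y) (edge_sym w y).
by case: (e x y); case: (e z w); case: (e x z); case: (e y w); case: (e x w);
  case: (e y z).
Qed.
End SignedGraph.

(** * Counting quadruples through a pair *)

(** Double counting of the pairs of a hyperedge [alpha] containing [s] and a vertex [z] of [alpha]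
    outside [s]. *)
Lemma uniform_extend (T : finType) (H : {set {set T}}) (k : nat) (s : {set T}) :
  (forall alpha, alpha \in H -> #|alpha| = k) ->
  (#|[set alpha in H | s \subset alpha]| * (k - #|s|) =
   \sum_(z | z \notin s) #|[set alpha in H | z |: s \subset alpha]|)%N.
Proof.
move=> hk; rewrite -sum_nat_const.
transitivity (\sum_(alpha in [set alpha in H | s \subset alpha])
    \sum_(z in alpha :\: s) 1)%N.
  apply: eq_bigr => al; rewrite inE => /andP[/hk hal sal].
  by rewrite sum1_card cardsD (setIidPr sal) hal.
rewrite (exchange_big_dep (fun z => z \notin s)) /=; last first.
  by move=> al z _; rewrite inE => /andP[].
apply: eq_bigr => z zs; rewrite -sum1_card; apply: eq_bigl => al.
by rewrite !inE zs /= subUset sub1set -andbA [(_ \subset _) && _]andbC.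
Qed.

(** Two applications of [uniform_extend], from 2 to 3 and from 3 to 4 vertices; the factor 2 counts
    the orders of the two remaining vertices. *)
Lemma pair_count (T : finType) (H : {set {set T}}) (x y : T) :
  (forall alpha, alpha \in H -> #|alpha| = 4%N) -> x != y ->
  (#|[set alpha in H | [set x; y] \subset alpha]| * 2 =
   \sum_(z | (z != x) && (z != y))
     \sum_(w | [&& w != x, w != y & w != z]) ([set x; y; z; w] \in H))%N.
Proof.
move=> hH xy.
have c2 : #|[set x; y]| = 2%N by rewrite cards2 xy.
have := uniform_extend [set x; y] hH; rewrite c2 => ->.
apply: eq_big => [z|z]; rewrite !inE negb_or // => /andP[zx zy].
have c3 : #|z |: [set x; y]| = 3%N by rewrite cardsU1 !inE negb_or zx zy c2.
have := uniform_extend (z |: [set x; y]) hH; rewrite c3 muln1 => ->.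
apply: eq_big => [w|w]; rewrite !inE !negb_or.
  by rewrite andbC -andbA.
case/and3P=> wz wx wy.
have -> : [set x; y; z; w] = w |: (z |: [set x; y]).
  by rewrite setUC [[set x; y] :|: _]setUC.
set t := w |: _.
have c4 : #|t| = 4%N by rewrite cardsU1 c3 !inE !negb_or wz wx wy.
have -> : [set alpha in H | t \subset alpha] = [set alpha in H | alpha == t].
  apply/setP => al; rewrite !inE; apply: andb_id2l => /hH hal.
  by rewrite eq_sym eqEcard hal c4 andbT.
case: (boolP (t \in H)) => tH.
  rewrite -[RHS](cards1 t); apply: eq_card => al; rewrite !inE.
  by case: eqP => [->|]; rewrite ?tH ?andbF.
apply/eqP; rewrite cards_eq0; apply/eqP/setP => al; rewrite !inE.
by case: eqP => [->|]; rewrite ?(negbTE tH) ?andbF.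
Qed.

Section Counting.
Variables (T : finType) (e : rel T) (d : nat).
Hypotheses (e_sym : symmetric e) (e_irr : irreflexive e).
Hypothesis degree : forall x, #|[set z | e x z]| = d.
Let cod x y := #|[set z | e x z && e y z]|.
Hypothesis codegree : forall x y, x != y -> cod x y = 0%N \/ cod x y = 2%N.
Hypothesis triangle_free : forall x y, e x y -> cod x y = 0%N.

Let E x y : int := (e x y)%:R.

Let ExE x y : E x y * E x y = E x y.
Proof. by rewrite /E; case: (e x y). Qed.
Let Exx x : E x x = 0. Proof. by rewrite /E e_irr. Qed.
Let EC x y : E x y = E y x. Proof. by rewrite /E e_sym. Qed.

Let sumE x : \sum_z E x z = d%:R.
Proof.
by rewrite -(degree x) -sum1dep_card natr_sum [RHS]big_mkcond;
  apply: eq_bigr => z _;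
  rewrite /E; case: (e x z).
Qed.

Let sumEE x y : \sum_z E x z * E y z = (cod x y)%:R.
Proof.
by rewrite /cod -sum1dep_card natr_sum [RHS]big_mkcond;
  apply: eq_bigr => z _;
  rewrite /E; case: (e x z); case: (e y z).
Qed.

Lemma sum_but2 (F : T -> int) x y : x != y ->
  \sum_(z | (z != x) && (z != y)) F z = \sum_z F z - F x - F y.
Proof.
move=> xy; rewrite [\sum_z F z](bigD1 x) //= [in RHS](bigD1 y) 1?eq_sym //=.
by rewrite [F x + _]addrC addrK [RHS]addrC addKr.
Qed.

Lemma sum_but3 (F : T -> int) x y z : x != y -> z != x -> z != y ->
  \sum_(w | [&& w != x, w != y & w != z]) F w = \sum_w F w - F x - F y - F z.
Proof.
move=> xy zx zy; rewrite -(sum_but2 _ xy) [in RHS](bigD1 z) ?zx //=.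
by rewrite [RHS]addrC addKr; apply: eq_bigl => w; rewrite andbA.
Qed.

Lemma matchings_count (a : int) x y : a = 0 \/ a = 1 -> x != y ->
  let c : int := (cod x y)%:R in
  \sum_(z | (z != x) && (z != y))
     \sum_(w | [&& w != x, w != y & w != z])
       ((matchings e x y z w)%:R ^+ 2 == a)%:R =
  (1 - a) * ((#|T|%:R - 2) * (#|T|%:R - 3))
  + (2 * a - 1) * (2 * ((d%:R - E x y) ^+ 2 - c)
     + E x y * (#|T|%:R * d%:R - 4 * d%:R + 2)
     - (1 + a) * (c * (c - 1) + 2 * E x y * (d%:R - 1))).
Proof.
move=> ha xy c.
pose N : int := #|T|%:R.
have sum1 : \sum_(z : T) (1 : int) = N.
  by rewrite sumr_const cardT /N cardE.
have cE z : E x z * E y z * E x y = 0.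
  rewrite /E; case exy: (e x y); rewrite ?mulr0 //.
  case exz: (e x z); rewrite ?mul0r //; case eyz: (e y z) => //.
  have := triangle_free exy; rewrite /cod => /eqP; rewrite cards_eq0.
  by move=> /eqP/setP/(_ z); rewrite !inE exz eyz.
(* The common neighbour [u] makes the codegree nonzero, which leaves only the value 2. *)
have two_path u v w : w != v -> E u v * E u w = 1 -> (cod w v)%:R = 2 :> int.
  move=> wv; rewrite /E; case euv: (e u v); case euw: (e u w) => // _.
  have [/eqP h|-> //] := codegree wv; move: h; rewrite cards_eq0.
  by move=> /eqP/setP/(_ u); rewrite !inE e_sym euw e_sym euv.
have E01 u v : E u v = 0 \/ E u v = 1.
  by rewrite /E; case: (e u v); [right | left].
have idem : E x y ^+ 2 = E x y by rewrite expr2 ExE.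
(* Coefficients of the sum over [w] as a polynomial in [E x z] and [E y z]. In the quadrangle terms
   containing [E x y] the sum over [w] is 1: by [two_path] the codegree is 2, and one of the common
   neighbours is the excluded [x] or [y]. *)
pose k : int := (1 - a) * (N - 3) + (2 * a - 1) * (E x y * d%:R).
pose al : int := (2 * a - 1) * (d%:R - (3 + a) * E x y).
pose be : int := (2 * a - 1) * (- 2 - (1 + a) * (c - 1)).
have inner z : (z != x) && (z != y) ->
  \sum_(w | [&& w != x, w != y & w != z])
     ((matchings e x y z w)%:R ^+ 2 == a)%:R =
  k * 1 + al * (E x z + E y z) + be * (E x z * E y z).
  case/andP=> zx zy.
  (* With s1 and s2 the first two elementary symmetric functions of the three matching indicators,
     at most two of which are nonzero by [cE], the indicator of no matching is 1 - s1 + s2 and that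
     of exactly one is s1 - 2 s2. Both are (1 - a) + (2a - 1)(s1 - (1 + a) s2). *)
  transitivity (\sum_(w | [&& w != x, w != y & w != z])
    ((1 - a) * 1 + (2 * a - 1) *
      (E x y * E z w + E x z * E y w + E y z * E x w
       - (1 + a) * (E x y * E x z * (E z w * E y w)
         + E x y * E y z * (E z w * E x w)
         + E x z * E y z * (E x w * E y w))))).
    apply: eq_bigr => w _; have := cE z; have := cE w.
    rewrite /E /matchings.
    by case: ha => ->; case: (e x y); case: (e z w); case: (e x z);
      case: (e y w); case: (e x w); case: (e y z).
  rewrite sum_but3 // !(big_split, sumrN, =^~ mulr_sumr) /=.
  rewrite sum1 !sumE !sumEE -/c !Exx (EC z x) (EC z y) (EC y x) /k /al /be.
  have := cE z; have := two_path x y z zy; have := two_path y x z zx.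
  rewrite (EC y x).
  case: (E01 x y) => ->; case: (E01 x z) => ->; case: (E01 y z) => ->;
    rewrite ?(mulr0, mul0r, mulr1) => h1 h2 // _;
    rewrite ?(h1 erefl) ?(h2 erefl); ring.
rewrite (eq_bigr _ inner) sum_but2 //.
rewrite !(big_split, =^~ mulr_sumr) /= sum1 !sumE sumEE -/c !Exx (EC y x).
rewrite /k /al /be -/N.
case: (E01 x y) => ->; ring.
Qed.
End Counting.

(** * Pair counts in the hypercube and the block design *)

Lemma cards4 (T : finType) (x y z w : T) :
  uniq [:: x; y; z; w] -> #|[set x; y; z; w]| = 4%N.
Proof.
move=> u; rewrite -[RHS]/(size [:: x; y; z; w]) -(card_uniqP u).
apply: eq_card => t; rewrite !inE.
by rewrite -!orbA.
Qed.

Definition hypercube_pair_count (d : nat) (a : int) (x y : 'I_(2 ^ d)) : nat :=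
  #|[set alpha in det_hypergraph (signed_cube d) 4 a |
      [set x; y] \subset alpha]|.

(** The right-hand side depends on the pair only through its distance [h]. The count stays doubled,
    as in [pair_count], to avoid division. *)
Lemma hypercube_pair_countE (d : nat) (a : int) (x y : 'I_(2 ^ d)) :
  a = 0 \/ a = 1 -> x != y ->
  let h := ham (code x) (code y) in
  let E : int := (h == 1%N)%:R in let c : int := (2 * (h == 2))%:R in
  (hypercube_pair_count a x y)%:Z * 2 =
  (1 - a) * (((2 ^ d)%N%:R - 2) * ((2 ^ d)%N%:R - 3))
  + (2 * a - 1) * (2 * ((d%:R - E) ^+ 2 - c)
     + E * ((2 ^ d)%N%:R * d%:R - 4 * d%:R + 2)
     - (1 + a) * (c * (c - 1) + 2 * E * (d%:R - 1))).
Proof.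
move=> ha xy h E c.
pose e (u v : 'I_(2 ^ d)) := ham (code u) (code v) == 1%N.
have e_irr : irreflexive e by move=> u; rewrite /e hamxx.
have e_sym : symmetric e by move=> u v; rewrite /e ham_sym.
have deg u : #|[set z | e u z]| = d.
  by rewrite (card_code (fun z => ham (code u) z == 1%N)) ham_degree card_ord.
have codE u v : u != v -> #|[set z | e u z && e v z]| =
    (2 * (ham (code u) (code v) == 2))%N.
  move=> uv; rewrite (card_code (fun z => (ham (code u) z == 1%N) &&
    (ham (code v) z == 1%N))) ham_codegree //.
  by rewrite (inj_eq (@code_inj d)).
have cod02 u v : u != v -> #|[set z | e u z && e v z]| = 0%N \/
    #|[set z | e u z && e v z]| = 2%N.
  by move=> /codE->; case: (_ == _); [right | left].
have tri u v : e u v -> #|[set z | e u z && e v z]| = 0%N.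
  move=> euv; rewrite codE; first by move: euv; rewrite /e => /eqP->.
  by apply: contraTneq euv => ->; rewrite e_irr.
have := matchings_count e_sym e_irr deg cod02 tri ha xy.
rewrite /= codE // card_ord -/h -/c -[(e x y)%:R]/E => <-.
rewrite /hypercube_pair_count -[2]/(2%N%:Z) -PoszM pair_count //; last first.
  by move=> al; rewrite inE => /andP[/eqP].
rewrite -[Posz _]natz natr_sum; apply: eq_bigr => z /andP[zx zy].
rewrite natr_sum; apply: eq_bigr => w /and3P[wx wy wz].
have u : uniq [:: x; y; z; w].
  by rewrite /= !inE !negb_or xy eq_sym zx eq_sym
     wx eq_sym zy eq_sym wy eq_sym wz.
rewrite inE; have /eqP-> := cards4 u; rewrite /=.
rewrite (det_principal4 (e := e) (signed_cube_sym d) (signed_cube_sqr d)) //.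
- exact: signed_cube_norm.
by move=> s t st; case: (cod02 s t st) => ->.
Qed.

Lemma hypercube_pair_count_ham (d : nat) (a : int) (x y x' y' : 'I_(2 ^ d)) :
  a = 0 \/ a = 1 -> x != y -> ham (code x) (code y) = ham (code x') (code y') ->
  hypercube_pair_count a x y = hypercube_pair_count a x' y'.
Proof.
move=> ha xy h.
have xy' : x' != y'.
  by rewrite -(inj_eq (@code_inj d)) -ham_eq0 -h ham_eq0 (inj_eq (@code_inj d)).
have := hypercube_pair_countE ha xy'; have := hypercube_pair_countE ha xy.
rewrite h /= => <- /(@mulIf _ (2 : int) isT) e.
by case: e.
Qed.

(* 'C(2 ^ d - 2, 2), the number of 4-subsets that contain a given pair, corrects
   the printed 'C(2 ^ d, 4), for which the claim fails when a = 0 and d >= 3. *)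
Theorem theorem3p10 (d : nat) (hd : (2 <= d)%N) (a : int)
    (ha : a = 0 \/ a = 1) (lambda : nat -> int)
    (lambda_1 : lambda 1%N =
       (1 - a) * ('C(2 ^ d - 2, 2))%:Z
       + (2 * a - 1) * (d%:Z ^+ 2 + d%:Z * (2 ^+ d.-1 - 5 - a) + 3 + a))
    (lambda_2 : lambda 2%N =
       (1 - a) * ('C(2 ^ d - 2, 2))%:Z + (2 * a - 1) * (d%:Z ^+ 2 - 3 - a))
    (lambda_i : forall i : nat, (3 <= i <= d)%N -> lambda i =
       (1 - a) * ('C(2 ^ d - 2, 2))%:Z + (2 * a - 1) * d%:Z ^+ 2) :
  PBIBD 4 lambda (@hamming_scheme d) (det_hypergraph (signed_cube d) 4 a).
Proof.
have hk alpha : alpha \in det_hypergraph (signed_cube d) 4 a -> #|alpha| = 4%N.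
  by rewrite inE => /andP[/eqP].
split; first exact: symmetric_scheme_hamming.
  pose H := det_hypergraph (signed_cube d) 4 a.
  pose r (x : 'I_(2 ^ d)) := #|[set alpha in H | [set x] \subset alpha]|.
  (* Each hyperedge through [x] has three further vertices. *)
  have rE x : (r x * 3 = \sum_(z | z != x) hypercube_pair_count a x z)%N.
    have := uniform_extend [set x] hk; rewrite cards1 => ->.
    by apply: eq_big => [z|z _]; rewrite ?inE // setUC.
  have r_const x y : r x = r y.
    apply/eqP; rewrite -(eqn_pmul2r (isT : 0 < 3)%N) !rE.
    (* The degenerate pairs at distance 0 turn distance transitivity into vertex transitivity. *)
    have hxy : ham (code x) (code x) = ham (code y) (code y) by rewrite !hamxx.
    have [phi [phi_inj hphi phix _]] := code_isometry hxy.
    rewrite [X in _ == X](reindex_inj phi_inj) /=; apply/eqP.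
    rewrite -phix; apply: eq_big => [z|z zx]; first by rewrite (inj_eq phi_inj).
    by apply: hypercube_pair_count_ham; rewrite // eq_sym.
  have v0 : (0 < 2 ^ d)%N by rewrite expn_gt0.
  exists (r (Ordinal v0)); split=> // s /eqP/cards1P[x ->].
  exact: r_const.
move=> i i0 x y; rewrite hamming_schemeE => /eqP hi.
have xy : x != y.
  by apply: contraTneq i0 => exy; rewrite -hi exy hamxx.
(* Doubling matches the pair count and clears the halves in the binomial and in [2 ^+ d.-1]. *)
apply: (@mulIf _ (2 : int)) => //.
rewrite [LHS](hypercube_pair_countE ha xy) hi.
(* This bound makes the truncated subtractions in the binomial agree with integer ones. *)
have h4 : (4 <= 2 ^ d)%N by rewrite -[4%N]/(2 ^ 2)%N leq_exp2l.
have binE : ('C(2 ^ d - 2, 2))%:Z * 2 = ((2 ^ d)%N%:R - 2) * ((2 ^ d)%N%:R - 3).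
  rewrite -[2 in LHS]/((2`!)%N%:Z) -PoszM bin_ffact !ffactnS ffactn0.
  lia.
have powE : (2 : int) ^+ d.-1 * 2 = (2 ^ d)%N%:R.
  by rewrite natrX -exprSr prednK // (leq_trans _ hd).
have binD u : ((1 - a) * ('C(2 ^ d - 2, 2))%:Z + u) * 2 =
    (1 - a) * (((2 ^ d)%N%:R - 2) * ((2 ^ d)%N%:R - 3)) + u * 2.
  by rewrite -binE; ring.
have := ltn_ord i; move: i0 hi; case: (nat_of_ord i) => [//|[|[|k]]] _ _ hid.
- rewrite lambda_1 binD -powE /= natz; ring.
- rewrite lambda_2 binD /= natz; ring.
rewrite lambda_i // binD /= natz; ring.
Qed.
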